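(* Work in homotopy type theory with univalence and function extensionality. Let $f : A \to B$, $g : B \to A$, $\eta : gf \sim \mathsf{id}_A$, $\varepsilon : fg \sim \mathsf{id}_B$ and $\tau : f[\eta] \sim \varepsilon_f$ (i.e. $(g,\eta,\varepsilon,\tau) : \mathsf{ishadj}\, f$). Then the type \[ \sum_{\theta : \eta_{g} \sim g[\varepsilon]} \big(\tau_{g} \cdot \mathsf{Coh}\, \varepsilon \sim f \llbracket \theta \rrbracket\big) \] is contractible.
   Context: $\mathsf{ishadj}\, f :\equiv \sum_{g : B \to A} \sum_{\eta : gf \sim \mathsf{id}_A} \sum_{\varepsilon : fg \sim \mathsf{id}_B} (f[\eta] \sim \varepsilon_f)$. Notation: for $h : X \to Y$ and a path $p$, $h[p]$ denotes $\mathsf{ap}_h(p)$; for 2-paths $\alpha : p = q$, $h\llbracket \alpha \rrbracket : h[p] = h[q]$ is the action on 2-paths. A homotopy $H : F \sim G$ is an element of $\prod_x Fx = Gx$; $H_k := \lambda c.\, H_{kc}$, $h[H] := \lambda x.\, h[H_x]$, $h\llbracket \alpha\rrbracket := \lambda x.\, h\llbracket \alpha_x\rrbracket$ for $\alpha : H \sim H'$; $\cdot$ is pointwise concatenation in diagrammatic order. The homotopy $\mathsf{Coh}\, \varepsilon : \varepsilon_{fg} \sim f[g[\varepsilon]]$ is defined pointwise: $(\mathsf{Coh}\,\varepsilon)_y : \varepsilon_{f(gy)} = f[g[\varepsilon_y]]$ is the concatenation of the path $\varepsilon_{f(gy)} = (fg)[\varepsilon_y]$ given by naturality of $\varepsilon$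 (applied to $\varepsilon_y$, cancelling $\varepsilon_y$) with the functoriality path $(fg)[\varepsilon_y] = f[g[\varepsilon_y]]$. *)

(* Defs.v *)
(* We use our own Type-valued identity type [paths] rather than Stdlib's
   Prop-valued [eq], so that whitelisted axioms such as proof irrelevance
   do not collapse higher paths. *)

Inductive paths {A : Type} (a : A) : A -> Type := idpath : paths a a.
Arguments idpath {A a}.

Definition concat {A : Type} {x y z : A} (p : paths x y) (q : paths y z) : paths x z :=
  match q in paths _ w return paths x w with idpath => p end.

Definition inv {A : Type} {x y : A} (p : paths x y) : paths y x :=
  match p in paths _ w return paths w x with idpath => idpath end.

(* h[p] := ap_h(p); h⟦α⟧ is [ap (ap h) α]. *)
Definition ap {X Y : Type} (h : X -> Y) {x y : X} (p : paths x y) : paths (h x) (h y) :=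
  match p in paths _ w return paths (h x) (h w) with idpath => idpath end.

Definition concat_1p {A : Type} {x y : A} (p : paths x y) : paths (concat idpath p) p :=
  match p in paths _ w return paths (concat idpath p) p with idpath => idpath end.

Definition nat_id {X : Type} {F : X -> X} (H : forall x, paths (F x) x)
  {x y : X} (p : paths x y) : paths (concat (H x) p) (concat (ap F p) (H y)) :=
  match p in paths _ w return paths (concat (H x) p) (concat (ap F p) (H w)) with
  | idpath => inv (concat_1p (H x))
  end.

Definition cancelR {A : Type} {x y z : A} {p q : paths x y} (r : paths y z)
  : paths (concat p r) (concat q r) -> paths p q :=
  match r in paths _ w return paths (concat p r) (concat q r) -> paths p q with
  | idpath => fun e => e
  end.

Definition ap_compose {X Y Z : Type} (g : X -> Y) (f : Y -> Z) {x y : X} (p : paths x y)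
  : paths (ap (fun t => f (g t)) p) (ap f (ap g p)) :=
  match p in paths _ w return paths (ap (fun t => f (g t)) p) (ap f (ap g p)) with
  | idpath => idpath
  end.

Definition Coh {A B : Type} (f : A -> B) (g : B -> A)
  (eps : forall b, paths (f (g b)) b) (y : B)
  : paths (eps (f (g y))) (ap f (ap g (eps y))) :=
  concat (cancelR (eps y) (nat_id eps (eps y))) (ap_compose g f (eps y)).

Definition ishadj {A B : Type} (f : A -> B) : Type :=
  { g : B -> A &
  { eta : forall a, paths (g (f a)) a &
  { eps : forall b, paths (f (g b)) b &
    forall a, paths (ap f (eta a)) (eps (f a)) } } }.

Definition IsContr (T : Type) : Type := { c : T & forall x : T, paths c x }.

Definition happly {X : Type} {P : X -> Type} {h k : forall x, P x}
  (p : paths h k) : forall x, paths (h x) (k x) :=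
  match p in paths _ w return forall x, paths (h x) (w x) with
  | idpath => fun x => idpath
  end.

Definition Funext : Type :=
  forall (X : Type) (P : X -> Type) (h k : forall x, P x), ishadj (@happly X P h k).

(* Main.v *)
Require Import Defs.

(* A half-adjoint equivalence has contractible fibres, and the
   fibre of [ap h] over [q : h x = h y] is a path space in the fibre of [h]
   over [h y], so [ap h] inherits contractible fibres.  Applied twice, the
   type of pairs (θ_b, witness) at a fixed [b] is (up to reversing the
   witness) a fibre of [ap (ap f)], hence contractible, whatever the target
   path [τ_{gb} · Coh ε_b] is.  By function extensionality a product of
   contractible types is contractible, and the Σ-type of the statement is
   that product with Π distributed over Σ. *)

Definition fib {X Y : Type} (h : X -> Y) (y : Y) : Type := {x : X & paths (h x) y}.

Definition IsContrMap {X Y : Type} (h : X -> Y) : Type := forall y, IsContr (fib h y).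

Lemma inv_inv {X : Type} {a b : X} (e : paths a b) : paths (inv (inv e)) e.
Proof. destruct e. exact idpath. Defined.

Lemma concat_Vp {X : Type} {a b : X} (q : paths a b) : paths (concat (inv q) q) idpath.
Proof. destruct q. exact idpath. Defined.

Lemma contr_retract {X Y : Type} (r : X -> Y) (s : Y -> X) :
  (forall y, paths (r (s y)) y) -> IsContr X -> IsContr Y.
Proof.
  intros rs [c K]. exists (r c). intro y.
  exact (concat (ap r (K (s y))) (rs y)).
Defined.

Lemma contr_paths {X : Type} : IsContr X -> forall a b : X, IsContr (paths a b).
Proof.
  intros [c K] a b. exists (concat (inv (K a)) (K b)).
  intros []. apply concat_Vp.
Defined.

Lemma contr_forall (fe : Funext) {X : Type} {P : X -> Type} :
  (forall x, IsContr (P x)) -> IsContr (forall x, P x).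
Proof.
  intro C. exists (fun x => projT1 (C x)). intro k.
  destruct (fe X P (fun x => projT1 (C x)) k) as [happly_inv _].
  apply happly_inv. intro x. exact (projT2 (C x) (k x)).
Defined.

Lemma contr_sig_forall (fe : Funext) {X : Type} {P : X -> Type}
  {Q : forall x, P x -> Type} :
  (forall x, IsContr {t : P x & Q x t}) ->
  IsContr {th : forall x, P x & forall x, Q x (th x)}.
Proof.
  intro C.
  apply (contr_retract
           (fun k => existT (fun th => forall x, Q x (th x))
                       (fun x => projT1 (k x)) (fun x => projT2 (k x)))
           (fun th x => existT (Q x) (projT1 th x) (projT2 th x))).
  - intros [th w]. exact idpath.
  - exact (contr_forall fe C).
Defined.

Lemma contr_fib_sym {X Y : Type} (h : X -> Y) (y : Y) :
  IsContr (fib h y) -> IsContr {x : X & paths y (h x)}.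
Proof.
  apply (contr_retract (fun u => existT _ (projT1 u) (inv (projT2 u)))
                       (fun u => existT _ (projT1 u) (inv (projT2 u)))).
  intros [x e]. simpl. destruct (inv (inv_inv e)). exact idpath.
Defined.

Lemma path_fib {X Y : Type} (h : X -> Y) {z : Y} {x1 x2 : X} (e : paths x1 x2)
  (u : paths (h x1) z) (v : paths (h x2) z) :
  paths u (concat (ap h e) v) ->
  paths (existT (fun x => paths (h x) z) x1 u) (existT (fun x => paths (h x) z) x2 v).
Proof.
  destruct e. simpl. intro H. destruct (concat H (concat_1p v)). exact idpath.
Defined.

Lemma path_fib_snd {X Y : Type} (h : X -> Y) {z : Y} (u v : fib h z) (w : paths u v) :
  paths (projT2 u) (concat (ap h (ap (@projT1 _ _) w)) (projT2 v)).
Proof. destruct w. exact (inv (concat_1p _)). Defined.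

Lemma contr_map_hadj {X Y : Type} (h : X -> Y) : ishadj h -> IsContrMap h.
Proof.
  intros [k [et [ep ta]]] y. exists (existT _ (k y) (ep y)).
  intros [x []].
  apply (path_fib h (et x) (ep (h x)) idpath). exact (inv (ta x)).
Defined.

Definition fib_ap_of_path {X Y : Type} (h : X -> Y) {x y : X} {q : paths (h x) (h y)}
  (w : paths (existT (fun x' => paths (h x') (h y)) x q)
             (existT (fun x' => paths (h x') (h y)) y idpath)) :
  fib (@ap X Y h x y) q :=
  existT _ (ap (@projT1 _ _) w) (inv (path_fib_snd h _ _ w)).

Definition path_of_fib_ap {X Y : Type} (h : X -> Y) {x y : X} {q : paths (h x) (h y)}
  (pe : fib (@ap X Y h x y) q) :
  paths (existT (fun x' => paths (h x') (h y)) x q)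
        (existT (fun x' => paths (h x') (h y)) y idpath).
Proof. destruct pe as [p e]. destruct e, p. exact idpath. Defined.

Lemma fib_ap_of_pathK {X Y : Type} (h : X -> Y) {x y : X} {q : paths (h x) (h y)}
  (pe : fib (@ap X Y h x y) q) :
  paths (fib_ap_of_path h (path_of_fib_ap h pe)) pe.
Proof. destruct pe as [p e]. destruct e, p. exact idpath. Defined.

Lemma contr_map_ap {X Y : Type} (h : X -> Y) :
  IsContrMap h -> forall x y : X, IsContrMap (@ap X Y h x y).
Proof.
  intros H x y q.
  apply (contr_retract _ _ (@fib_ap_of_pathK X Y h x y q)).
  apply contr_paths, H.
Defined.

Theorem lemma3p7 (fe : Funext) (A B : Type) (f : A -> B) (g : B -> A)
  (eta : forall a : A, paths (g (f a)) a)
  (eps : forall b : B, paths (f (g b)) b)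
  (tau : forall a : A, paths (ap f (eta a)) (eps (f a))) :
  IsContr
    { theta : forall b : B, paths (eta (g b)) (ap g (eps b)) &
      forall b : B, paths (concat (tau (g b)) (Coh f g eps b)) (ap (ap f) (theta b)) }.
Proof.
  assert (f_contr : IsContrMap f)
    by exact (contr_map_hadj f (existT _ g (existT _ eta (existT _ eps tau)))).
  apply (contr_sig_forall fe
           (Q := fun b t => paths (concat (tau (g b)) (Coh f g eps b)) (ap (ap f) t))).
  intro b.
  apply contr_fib_sym.
  exact (contr_map_ap _ (contr_map_ap f f_contr _ _) _ _ _).
Qed.
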